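(* Let $m_r=1/\mu_r$ for $r=0,1,2$. In the two-stage clearing system described in the context, the following hold. 1. Suppose that the condition $m_1h_1\ge m_2h_2$ does not hold or holds with equality, i.e. $m_1h_1\le m_2h_2$. If $m_1\le m_2$, there exists an optimal policy that always works at Station 1 (except to avoid unforced idling) for all states $(i,j,k,\ell)\in\mathbb{X}_{\widehat D}$. 2. Suppose that $m_1h_1\ge m_2h_2$ and in addition $m_1h_1\le 2m_2h_2$. In the case that $m_2<m_1\le 2m_2$, there exists an optimal policy that chooses to work at Station 1 for all states of the form $(i,1,0,1)$.
   Context: Model. A clearing system (no external arrivals, a finite number of initial jobs) has two servers. Each job first receives Phase I service at Station 0 from one server (both servers may work in parallel there). When a Station 0 service completes, the same server, together with the job, must perform Phase II either at Station 1 (action $a=1$; parallel, service begins immediately) or at Station 2 (action $a=2$; a single-service facility handling one job at a time, so the job-server pair may have to queue). A server cannot begin service on another job until its current job has completed both phases; it then starts a new Station 0 service if a job is waiting there. Services are non-preemptive and exponential with rates $\mu_0,\mu_1,\mu_2>0$ at Stations 0, 1, 2; $m_r=1/\mu_r$ are the mean service times. Holding costs are charged at non-negative rates $h_0,h_1,h_2$ per job per unit time for jobs (waiting or in service) at Stations 0, 1, 2 respectively. The objective is to minimize the expected total holding cost until the system is empty. States are $(i,j,k,\ell)$: $i$ jobs in the Station 0 queue (not in service), $j$ in service at Station 0, $k$ in service at Station 1, $\ell$ at Station 2 (waiting or in service). The state space is $\mathbb{X}=\{(i,j,k,\ell)\in\mathbb{Z}_+^4 : (i=0,\ j+k+\ell=1)\text{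 or }(i\ge 0,\ j+k+\ell=2)\}$, together with the empty state $(0,0,0,0)$. The decision states (an action is chosen for the job completing Station 0 service) are $\mathbb{X}_D=\{(0,1,0,0)\}\cup\{(i,2,0,0),(i,1,0,1),(i,1,1,0): i\ge 0\}$, and $\mathbb{X}_{\widehat D}=\mathbb{X}_D\setminus\{(0,1,0,0)\}$. Value function. Let $v(i,j,k,\ell)$ be the minimal expected total cost from state $(i,j,k,\ell)$, with $v(0,0,0,0)=0$. With $d=d(j,k,\ell)=j\mu_0+k\mu_1+\min\{\ell,1\}\mu_2$, it satisfies, at every non-empty state (terms with zero coefficient are read as zero): for $i=0$, $$v(0,j,k,\ell)=\tfrac{1}{d}\big[jh_0+kh_1+\ell h_2+k\mu_1 v(0,j,k-1,\ell)+\min\{\ell,1\}\mu_2 v(0,j,k,\ell-1)+j\mu_0\min\{v(0,j-1,k+1,\ell),v(0,j-1,k,\ell+1)\}\big],$$ and for $i\ge 1$, $$v(i,j,k,\ell)=\tfrac{1}{d}\big[(i+j)h_0+kh_1+\ell h_2+k\mu_1 v(i-1,j+1,k-1,\ell)+\min\{\ell,1\}\mu_2 v(i-1,j+1,k,\ell-1)+j\mu_0\min\{v(i,j-1,k+1,\ell),v(i,j-1,k,\ell+1)\}\big].$$ A policy assigns an action in $\{1,2\}$ to each decision state; it is optimal if it attains the minimum in these equations at every decision state. Thus working at Station 1 (resp. Station 2) is an optimal decision at $(i,j,k,\ell)\in\mathbb{X}_D$ iff $v(i,j-1,k+1,\ell)-v(i,j-1,k,\ell+1)\le 0$ (resp.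 $\ge 0$). The parenthetical ''(except to avoid unforced idling)'' in part 1 is quoted as the authors print it; they give no formal definition of ''unforced idling''. *)

(* Defs.v *)
From HB Require Import structures.
From mathcomp Require Import all_boot all_order all_algebra.
From mathcomp Require Import boolp classical_sets reals.
From mathcomp Require Import zify.

Set Implicit Arguments.
Unset Strict Implicit.
Unset Printing Implicit Defensive.

Import Order.TTheory GRing.Theory Num.Theory.
Local Open Scope ring_scope.

Record clearing_system (R : realType) := ClearingSystem {
  mu0 : R; mu1 : R; mu2 : R;    (* service rates *)
  h0 : R; h1 : R; h2 : R;       (* holding cost rates *)
  mu0_gt0 : 0 < mu0; mu1_gt0 : 0 < mu1; mu2_gt0 : 0 < mu2;
  h0_ge0 : 0 <= h0; h1_ge0 : 0 <= h1; h2_ge0 : 0 <= h2 }.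

(* (i, j, k, l): i jobs queued at Station 0, j in service at Station 0, k in
   service at Station 1, l at Station 2 (waiting or in service).  The functions
   below are total on these tuples, but the dynamics started from a state with
   (i = 0 and j + k + l = 1) or j + k + l = 2 only visits such states and
   (0, 0, 0, 0). *)
Definition state := (nat * nat * nat * nat)%type.

Inductive action := Station1 | Station2.

Definition decision_state_hat (s : state) : bool :=
  let: (i, j, k, l) := s in
  [|| (j, k, l) == (2, 0, 0)%N, (j, k, l) == (1, 0, 1)%N
    | (j, k, l) == (1, 1, 0)%N].

Definition decision_state (s : state) : bool :=
  (s == (0, 1, 0, 0)%N) || decision_state_hat s.

(* Values outside decision_state are irrelevant: no Station 0 service can
   complete there (within the state space).  Only Station 2 can make a server
   wait with its job: after choosing Station1 the pair is served at once. *)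
Definition policy := state -> action.

Definition route (a : action) (s : state) : state :=
  let: (i, j, k, l) := s in
  match a with
  | Station1 => (i, j.-1, k.+1, l)
  | Station2 => (i, j.-1, k, l.+1)
  end.

(* The server released by a Phase II completion takes the next queued job. *)
Definition start_next (s : state) : state :=
  let: (i, j, k, l) := s in
  if i is i'.+1 then (i', j.+1, k, l) else s.

Definition finish1 (s : state) : state :=
  let: (i, j, k, l) := s in start_next (i, j, k.-1, l).

Definition finish2 (s : state) : state :=
  let: (i, j, k, l) := s in start_next (i, j, k, l.-1).

Section Costs.
Variables (R : realType) (S : clearing_system R).

Definition m1 : R := 1 / mu1 S.
Definition m2 : R := 1 / mu2 S.

Definition rate0 (s : state) : R := let: (i, j, k, l) := s in j%:R * mu0 S.
Definition rate1 (s : state) : R := let: (i, j, k, l) := s in k%:R * mu1 S.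
Definition rate2 (s : state) : R :=
  let: (i, j, k, l) := s in (minn l 1)%:R * mu2 S.

Definition total_rate (s : state) : R := rate0 s + rate1 s + rate2 s.

Definition holding_rate (s : state) : R :=
  let: (i, j, k, l) := s in (i + j)%:R * h0 S + k%:R * h1 S + l%:R * h2 S.

(* Expected cost up to the n-th service completion: the sojourn time in s is
   exponential with mean 1 / total_rate s, and each possible completion comes
   first with probability its rate / total_rate s.  At the empty state
   total_rate and all terms vanish, so the cost is 0 (as 0^-1 = 0). *)
Fixpoint cost_upto (n : nat) (p : policy) (s : state) : R :=
  if n is n'.+1 then
    holding_rate s / total_rate s
    + rate1 s / total_rate s * cost_upto n' p (finish1 s)
    + rate2 s / total_rate s * cost_upto n' p (finish2 s)
    + rate0 s / total_rate s * cost_upto n' p (route (p s) s)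
  else 0.

(* Number of service completions until the system is empty. *)
Definition phases (s : state) : nat :=
  let: (i, j, k, l) := s in (2 * (i + j) + k + l)%N.

Definition expected_cost (p : policy) (s : state) : R :=
  cost_upto (phases s) p s.

Definition value (s : state) : R :=
  inf [set expected_cost p s | p in [set: policy]]%classic.

Definition optimal (p : policy) : Prop :=
  forall s, decision_state s ->
    value (route (p s) s) =
    Num.min (value (route Station1 s)) (value (route Station2 s)).

(* The infimum is attained by one policy simultaneously at all states, and the
   value function satisfies the optimality equations. *)

Let rates_ge0 s : [/\ 0 <= rate0 s, 0 <= rate1 s & 0 <= rate2 s].
Proof.
move: s => [[[i j] k] l]; split=> /=; rewrite mulr_ge0 ?ler0n //.
- exact: ltW (mu0_gt0 S).
- exact: ltW (mu1_gt0 S).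
- exact: ltW (mu2_gt0 S).
Qed.

Let prob_ge0 s (x : R) : 0 <= x -> 0 <= x / total_rate s.
Proof.
have [r0 r1 r2] := rates_ge0 s.
by move=> x0; rewrite divr_ge0 // /total_rate !addr_ge0.
Qed.

Fixpoint min_cost_upto (n : nat) (s : state) : R :=
  if n is n'.+1 then
    holding_rate s / total_rate s
    + rate1 s / total_rate s * min_cost_upto n' (finish1 s)
    + rate2 s / total_rate s * min_cost_upto n' (finish2 s)
    + rate0 s / total_rate s *
        Num.min (min_cost_upto n' (route Station1 s))
                (min_cost_upto n' (route Station2 s))
  else 0.

Let next_phases s :
  [/\ rate1 s = 0 \/ phases s = (phases (finish1 s)).+1,
      rate2 s = 0 \/ phases s = (phases (finish2 s)).+1
    & rate0 s = 0 \/ forall a, phases s = (phases (route a s)).+1].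
Proof.
move: s => [[[i j] k] l]; split=> /=.
- case: k => [|k]; first by left; rewrite mul0r.
  by right; case: i => [|i] /=; lia.
- case: l => [|l]; first by left; rewrite min0n mul0r.
  by right; case: i => [|i] /=; lia.
- case: j => [|j]; first by left; rewrite mul0r.
  by right; case=> /=; lia.
Qed.

Definition greedy : policy := fun s =>
  if min_cost_upto (phases s).-1 (route Station1 s)
     <= min_cost_upto (phases s).-1 (route Station2 s)
  then Station1 else Station2.

Let min_cost_upto_le n p s : min_cost_upto n s <= cost_upto n p s.
Proof.
elim: n s => [//|n IH] s /=; have [r0 r1 r2] := rates_ge0 s.
do 3?[apply: lerD] => //; apply: ler_wpM2l; rewrite ?prob_ge0 // ge_min.
by case: (p s); rewrite IH ?orbT.
Qed.

Let expected_cost_greedy s : expected_cost greedy s = min_cost_upto (phases s) s.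
Proof.
rewrite /expected_cost; move eq_n: (phases s) => n.
elim: n s eq_n => [//|n IH] s eq_n /=; have [e1 e2 e0] := next_phases s.
congr (_ + _ + _ + _).
- case: e1 => [->|e1]; first by rewrite !mul0r.
  by rewrite IH //; apply: succn_inj; rewrite -e1.
- case: e2 => [->|e2]; first by rewrite !mul0r.
  by rewrite IH //; apply: succn_inj; rewrite -e2.
- case: e0 => [->|e0]; first by rewrite !mul0r.
  rewrite IH; last by apply: succn_inj; rewrite -e0.
  by rewrite /greedy eq_n /=; case: leP.
Qed.

Lemma value_min_cost s : value s = min_cost_upto (phases s) s.
Proof.
set A := [set expected_cost p s | p in [set: policy]]%classic.
have lbA : lbound A (min_cost_upto (phases s) s).
  by move=> _ [p _ <-]; exact: min_cost_upto_le.
apply/eqP; rewrite eq_le; apply/andP; split.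
- rewrite -expected_cost_greedy; apply: ge_inf; last by exists greedy.
  by exists (min_cost_upto (phases s) s).
- by apply: lb_le_inf => //; exists (expected_cost greedy s); exists greedy.
Qed.

Lemma value_attained s : value s = expected_cost greedy s.
Proof. by rewrite value_min_cost expected_cost_greedy. Qed.

Lemma value_empty : value (0, 0, 0, 0)%N = 0.
Proof. by rewrite value_min_cost. Qed.

Lemma value_optimality_equation s :
  value s = (total_rate s)^-1 *
    (holding_rate s + rate1 s * value (finish1 s) + rate2 s * value (finish2 s)
     + rate0 s *
         Num.min (value (route Station1 s)) (value (route Station2 s))).
Proof.
rewrite !value_min_cost; have [e1 e2 e0] := next_phases s.
case eq_n: (phases s) => [|n] /=.
  case: e1 => [-> |]; last by rewrite eq_n.
  case: e2 => [-> |]; last by rewrite eq_n.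
  case: e0 => [-> |/(_ Station1)]; last by rewrite eq_n.
  move: s eq_n => [[[i j] k] l] eq_n.
  have [-> -> -> ->] : [/\ i = 0, j = 0, k = 0 & l = 0]%N.
    by split; move: eq_n => /=; lia.
  by rewrite /= !mul0r !addr0 mulr0.
rewrite eq_n in e1 e2 e0; rewrite [RHS]mulrC !mulrDl; congr (_ + _ + _ + _).
- case: e1 => [->|[<-]]; first by rewrite !mul0r.
  by rewrite mulrAC.
- case: e2 => [->|[<-]]; first by rewrite !mul0r.
  by rewrite mulrAC.
- case: e0 => [->|e0]; first by rewrite !mul0r.
  by rewrite mulrAC; case: (e0 Station1) => <-; case: (e0 Station2) => <-.
Qed.

End Costs.

(* Main.v *)
(* Write x = m1 h1 and y = m2 h2, and let A i, B i, C i be the values when one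
   server is freed with i jobs in queue (and takes one, if any) while the other
   is at Station 0, 1, 2.  Both parts are inductions on i bounding C - B.

   Part 1: C i - B i >= y - x is preserved, since C (i+1) >= A i + y (finishing
   the Station 2 job at once saves at least its own holding cost), and it gives
   all the required comparisons.

   Part 2: B i - C i <= (x - y) + i h0 (m1 - m2) / 2 is preserved, since
   B (i+1) - A i is at most x plus the cost of delaying the i + 1 jobs at
   Station 0 by m1 / 2 each.  With m1 <= 2 m2 and x <= 2 y it yields
   v(i,0,1,1) <= v(i,0,0,2). *)
Require Import Defs.
From HB Require Import structures.
From mathcomp Require Import all_boot all_order all_algebra.
From mathcomp Require Import boolp classical_sets reals.
From mathcomp Require Import ring lra.
Import Order.TTheory GRing.Theory Num.Theory.
Local Open Scope ring_scope.

(** * Optimality equations cleared of denominators *)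

Section Value.
Variables (R : realType) (S : clearing_system R).

Let v : state -> R := value S.
Let x := m1 S * h1 S.
Let y := m2 S * h2 S.

(** Going through [start_next] lets empty and nonempty queues share the equations below; at [i.+1]
    these unfold to the values at (i,2,0,0), (i,1,1,0) and (i,1,0,1). *)
Definition value_start0 i := value S (start_next (i, 1, 0, 0)%N).
Definition value_start1 i := value S (start_next (i, 0, 1, 0)%N).
Definition value_start2 i := value S (start_next (i, 0, 0, 1)%N).
Let A := value_start0.
Let B := value_start1.
Let C := value_start2.

(** Expresses the holding rate through x, so that service rates enter the balance equations only
    polynomially. *)
Lemma h1E : h1 S = mu1 S * (m1 S * h1 S).
Proof. by rewrite /m1; have := mu1_gt0 S => ?; field; rewrite gt_eqF. Qed.

Lemma h2E : h2 S = mu2 S * (m2 S * h2 S).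
Proof. by rewrite /m2; have := mu2_gt0 S => ?; field; rewrite gt_eqF. Qed.

Lemma value_balance s : 0 < total_rate S s ->
  total_rate S s * v s =
    holding_rate S s + rate1 S s * v (finish1 s) + rate2 S s * v (finish2 s)
    + rate0 S s * Num.min (v (route Station1 s)) (v (route Station2 s)).
Proof.
by move=> t0; rewrite {1}/v value_optimality_equation mulVKf // gt_eqF.
Qed.

Let mus := (mu0_gt0 S, mu1_gt0 S, mu2_gt0 S).

Lemma value_020 i :
  2 * mu1 S * (v (i, 0, 2, 0)%N - B i) = i%:R * h0 S + 2 * (mu1 S * x).
Proof.
have [[? ?] ?] := mus; have := value_balance (i, 0, 2, 0)%N.
rewrite /total_rate /= !(mul0r, add0r, addr0) addn0 => /(_ ltac:(lra)) E.
by rewrite mulrBr E /B /value_start1 /v /x -h1E; ring.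
Qed.

Lemma value_011 i :
  (mu1 S + mu2 S) * v (i, 0, 1, 1)%N =
  i%:R * h0 S + mu1 S * x + mu2 S * y + mu1 S * C i + mu2 S * B i.
Proof.
have [[? ?] ?] := mus; have := value_balance (i, 0, 1, 1)%N.
rewrite /total_rate /= !(mul0r, mul1r, add0r, addr0) addn0 => /(_ ltac:(lra)) ->.
by rewrite /x /y -h1E -h2E.
Qed.

Lemma value_002 i :
  mu2 S * (v (i, 0, 0, 2)%N - C i) = i%:R * h0 S + 2 * (mu2 S * y).
Proof.
have [[? ?] ?] := mus; have := value_balance (i, 0, 0, 2)%N.
rewrite /total_rate /= !(mul0r, mul1r, add0r, addr0) addn0 => /(_ ltac:(lra)) E.
by rewrite mulrBr E /C /value_start2 /v /y -h2E; ring.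
Qed.

Lemma value_110 i :
  (mu0 S + mu1 S) * B i.+1 =
  (i%:R + 1) * h0 S + mu1 S * x + mu1 S * A i
  + mu0 S * Num.min (v (i, 0, 2, 0)%N) (v (i, 0, 1, 1)%N).
Proof.
have [[? ?] ?] := mus; have := value_balance (i, 1, 1, 0)%N.
rewrite /total_rate /= !(mul0r, mul1r, add0r, addr0) natrD => /(_ ltac:(lra)) E.
by rewrite /B /value_start1 /= [LHS]E /x -h1E.
Qed.

Lemma value_101 i :
  (mu0 S + mu2 S) * C i.+1 =
  (i%:R + 1) * h0 S + mu2 S * y + mu2 S * A i
  + mu0 S * Num.min (v (i, 0, 1, 1)%N) (v (i, 0, 0, 2)%N).
Proof.
have [[? ?] ?] := mus; have := value_balance (i, 1, 0, 1)%N.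
rewrite /total_rate /= !(mul0r, mul1r, add0r, addr0) natrD => /(_ ltac:(lra)) E.
by rewrite /C /value_start2 /= [LHS]E /y -h2E.
Qed.

Lemma value_start1_0 : B 0 = x.
Proof.
have [[_ u1] _] := mus; have := value_balance (0, 0, 1, 0)%N.
rewrite /total_rate /= !(mul0r, mul1r, add0r, addr0) /v value_empty => /(_ u1).
rewrite mulr0 addr0 [X in _ = X]h1E.
by apply: mulfI; rewrite gt_eqF.
Qed.

Lemma value_start2_0 : C 0 = y.
Proof.
have [_ u2] := mus; have := value_balance (0, 0, 0, 1)%N.
rewrite /total_rate /= !(mul0r, mul1r, add0r, addr0) /v value_empty => /(_ u2).
rewrite mulr0 addr0 [X in _ = X]h2E.
by apply: mulfI; rewrite gt_eqF.
Qed.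

(* One server works at Station 0 if i = 0 and both do if i > 0, so only bounds
   hold uniformly in i. *)
Lemma value_start0_bounds i :
  (i%:R + 1) * h0 S <= 2 * mu0 S * (A i - Num.min (B i) (C i))
    <= 2 * ((i%:R + 1) * h0 S).
Proof.
have [[u0 _] _] := mus; have h0_ge0 := h0_ge0 S.
case: i => [|i].
  have := value_balance (0, 1, 0, 0)%N.
  rewrite /total_rate /= !(mul0r, mul1r, add0r, addr0) => /(_ u0) E.
  by rewrite mulrBr -!mulrA E /B /C /value_start1 /value_start2 /v /=; lra.
have := value_balance (i, 2, 0, 0)%N.
rewrite /total_rate /= !(mul0r, mul1r, add0r, addr0) natrD => /(_ ltac:(lra)) E.
rewrite mulrBr E /B /C /value_start1 /value_start2 /v /= -[i.+1]addn1 natrD.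
have : 0 <= i%:R * h0 S by rewrite mulr_ge0.
by lra.
Qed.

End Value.

(** * The two inductions on the queue length *)

Section Comparisons.
Variables (R : realType) (S : clearing_system R).
Let v : state -> R := value S.
Let x := m1 S * h1 S.
Let y := m2 S * h2 S.
Let A := value_start0 R S.
Let B := value_start1 R S.
Let C := value_start2 R S.

Lemma station1_step i :
  x <= y -> mu2 S <= mu1 S -> y - x <= C i - B i ->
  [/\ v (i, 0, 2, 0)%N <= v (i, 0, 1, 1)%N,
      v (i, 0, 1, 1)%N <= v (i, 0, 0, 2)%N
    & y - x <= C i.+1 - B i.+1].
Proof.
move=> le_xy le_mu; have x_ge0 : 0 <= x.
  by rewrite mulr_ge0 ?h1_ge0 // divr_ge0 ?ltW ?mu1_gt0.
have w_ge0 : 0 <= i%:R * h0 S by rewrite mulr_ge0 ?h0_ge0.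
have /andP[_] := value_start0_bounds R S i.
have := (value_020 R S i, value_011 R S i, value_002 R S i).
have := (value_110 R S i, value_101 R S i).
rewrite -/v -/x -/y -/A -/B -/C.
have := (mu0_gt0 S, mu1_gt0 S, mu2_gt0 S).
move: le_mu; move: (mu0 S) (mu1 S) (mu2 S) => u0 u1 u2 le_u [[u0_gt0 u1_gt0] u2_gt0].
move: (v (i, 0, 2, 0)%N) (v (i, 0, 1, 1)%N) (v (i, 0, 0, 2)%N) => d e f.
move: (A i) (B i) (C i) (B i.+1) (C i.+1) => a b c b1 c1.
move: (i%:R : R) (h0 S) w_ge0 => n h w_ge0 [Eb Ec] [[Ed Ee] Ef] ha hbc.
have u12_gt0 : 0 < u1 + u2 by lra.
(* The gap hypothesis and x <= y make b the minimum of b and c. *)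
have {}ha : u0 * (a - b) <= n * h + h.
  have : Num.min b c = b by apply/min_idPl; lra.
  by move=> bcE; move: ha; rewrite bcE; lra.
have pP : 0 <= d - b - x by rewrite -(pmulr_rge0 _ u1_gt0); lra.
have qP : 0 <= f - c - 2 * y by rewrite -(pmulr_rge0 _ u2_gt0); lra.
have u1bc : 0 <= u1 * (c - b - (y - x)) by apply: mulr_ge0; lra.
have u2bc : 0 <= u2 * (c - b - (y - x)) by apply: mulr_ge0; lra.
(* With P = d - b - x, n h = 2 u1 P and (u1 + u2)(e - d) = (u1 - u2) P + u1 (c - b) + u2 (y - x). *)
have de : y - x <= e - d.
  have : 0 <= (u1 - u2) * (d - b - x) by apply: mulr_ge0; lra.
  by move=> ?; rewrite -(ler_pM2l u12_gt0); lra.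
have ef : e <= f.
  have : 0 <= u1 * (f - c - 2 * y) by apply: mulr_ge0; lra.
  have : 0 <= u1 * (2 * y - x) by apply: mulr_ge0; lra.
  have : 0 <= u2 * (2 * y - x) by apply: mulr_ge0; lra.
  by move=> ? ? ?; rewrite -(ler_pM2l u12_gt0); lra.
have led : d <= e by lra.
split=> //; move: Eb Ec; rewrite (min_idPl led) (min_idPl ef) => Eb Ec.
have eb : y <= e - b by rewrite -(ler_pM2l u12_gt0); lra.
(* By [ha], the holding term (n + 1) h in the equation for c1 absorbs u0 (a - b), leaving at least
   u0 (e - b) + u2 y. *)
have c1a : y <= c1 - a.
  have u02_gt0 : 0 < u0 + u2 by lra.
  have : 0 <= u0 * (e - b - y) by apply: mulr_ge0; lra.
  by move=> ?; rewrite -(ler_pM2l u02_gt0); lra.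
have u01_gt0 : 0 < u0 + u1 by lra.
(* Subtracting the equations: (u0 + u1)(c1 - b1) = (u1 - u2)(c1 - a) + u0 (e - d) + u2 y - u1 x. *)
have : 0 <= (u1 - u2) * (c1 - a - y) by apply: mulr_ge0; lra.
have : 0 <= u0 * (e - d - (y - x)) by apply: mulr_ge0; lra.
by move=> ? ?; rewrite -(ler_pM2l u01_gt0); lra.
Qed.

Lemma station1_optimal i :
  x <= y -> mu2 S <= mu1 S ->
  [/\ v (i, 0, 2, 0)%N <= v (i, 0, 1, 1)%N,
      v (i, 0, 1, 1)%N <= v (i, 0, 0, 2)%N
    & v (i, 1, 1, 0)%N <= v (i, 1, 0, 1)%N].
Proof.
move=> le_xy le_mu.
suff gap : y - x <= C i - B i.
  have [de ef] := station1_step i le_xy le_mu gap.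
  by rewrite /C /B /value_start2 /value_start1 /= => cb; split=> //; lra.
elim: i => [|i IH]; first by rewrite /B /C value_start1_0 value_start2_0.
by have [] := station1_step i le_xy le_mu IH.
Qed.

Lemma station1_second_step i :
  y <= x -> x <= 2 * y -> mu1 S < mu2 S -> mu2 S <= 2 * mu1 S ->
  B i - C i <= x - y + i%:R * (h0 S * (m1 S - m2 S) / 2) ->
  v (i, 0, 1, 1)%N <= v (i, 0, 0, 2)%N /\
  B i.+1 - C i.+1 <= x - y + i.+1%:R * (h0 S * (m1 S - m2 S) / 2).
Proof.
move=> le_yx le_x2y lt_mu le_mu.
have h_ge0 := h0_ge0 S; have n_ge0 : 0 <= i%:R :> R by [].
have /andP[ha _] := value_start0_bounds R S i; move: ha.
have := (value_020 R S i, value_011 R S i, value_002 R S i).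
have := (value_110 R S i, value_101 R S i).
rewrite -/v -/x -/y -/A -/B -/C -[i.+1]addn1 natrD addn1.
(* Here r = h0 m1 / 2 is the delay cost per queued job, and k, the slack per queued job, satisfies
   u2 k = (u2 - u1) r. *)
have kE : mu2 S * (h0 S * (m1 S - m2 S) / 2)
    = (mu2 S - mu1 S) * (h0 S / (2 * mu1 S)).
  have [? ?] := (mu1_gt0 S, mu2_gt0 S).
  by rewrite /m1 /m2; field; rewrite !gt_eqF.
have rE : h0 S = 2 * mu1 S * (h0 S / (2 * mu1 S)).
  by have ? := mu1_gt0 S; field; rewrite gt_eqF.
move: kE rE.
have := (mu0_gt0 S, mu1_gt0 S, mu2_gt0 S).
move: lt_mu le_mu (h0 S * _ / 2) (h0 S / _).
move: (mu0 S) (mu1 S) (mu2 S) => u0 u1 u2 lt_u le_u k r [[u0_gt0 u1_gt0] u2_gt0].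
move: (v (i, 0, 2, 0)%N) (v (i, 0, 1, 1)%N) (v (i, 0, 0, 2)%N) => d e f.
move: (A i) (B i) (C i) (B i.+1) (C i.+1) => a b c b1 c1.
move: (i%:R : R) (h0 S) n_ge0 h_ge0.
move=> n h n_ge0 h_ge0 kE rE [Eb Ec] [[Ed Ee] Ef] ha hbc.
have u12_gt0 : 0 < u1 + u2 by lra.
have r_ge0 : 0 <= r by rewrite -(pmulr_rge0 _ u1_gt0); lra.
have k_ge0 : 0 <= k.
  by rewrite -(pmulr_rge0 _ u2_gt0) kE; apply: mulr_ge0; lra.
have p_ge0 : 0 <= n * r by apply: mulr_ge0.
have g_ge0 : 0 <= n * k by apply: mulr_ge0.
have gE : u2 * (n * k) = (u2 - u1) * (n * r).
  by rewrite mulrCA kE mulrCA.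
have wE : n * h = 2 * u1 * (n * r) by rewrite {1}rE; ring.
have u2bc : 0 <= u2 * (x - y + n * k - (b - c)) by apply: mulr_ge0; lra.
have pP : d - b = x + n * r.
  have u1' : 2 * u1 != 0 by rewrite gt_eqF //; lra.
  by apply: (mulfI u1'); lra.
have q_ge0 : 0 <= f - c - 2 * y.
  have : 0 <= u1 * (n * r) by apply: mulr_ge0; lra.
  by move=> ?; rewrite -(pmulr_rge0 _ u2_gt0); lra.
(* With Q = f - c - 2 y, (u1 + u2)(f - e) is at least u1 Q - (u2 - u1) n r + (u1 + u2)(2 y - x).
   Since u2 Q = 2 u1 n r, the first two terms sum to (2 u1 - u2)(Q / 2 + n r). *)
have ef : e <= f.
  have : 0 <= (2 * u1 - u2) * (f - c - 2 * y) by apply: mulr_ge0; lra.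
  have : 0 <= (2 * u1 - u2) * (n * r) by apply: mulr_ge0; lra.
  have : 0 <= u1 * (2 * y - x) by apply: mulr_ge0; lra.
  have : 0 <= u2 * (2 * y - x) by apply: mulr_ge0; lra.
  by move=> ? ? ? ?; rewrite -(ler_pM2l u12_gt0); lra.
split=> //; move: Eb Ec; rewrite (min_idPl ef) => Eb Ec.
set M := Num.min d e in Eb.
have Me : M <= e by rewrite ge_min lexx orbT.
have Md : M <= d by rewrite ge_min lexx.
(* If b is the minimum, compare with d; if c is, compare with e, where the gap hypothesis gives
   exactly x + n r. *)
have MP : M - Num.min b c <= x + n * r.
  have [bc|cb] := leP b c; first by lra.
  suff : e - c <= x + n * r by lra.
  by rewrite -(ler_pM2l u12_gt0); lra.
(* The lower bound [ha] on a cancels half of (n + 1) h; the other half is u1 (n + 1) r. *)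
have b1a : b1 - a <= x + n * r + r.
  have u01_gt0 : 0 < u0 + u1 by lra.
  have : 0 <= u0 * (x + n * r - (M - Num.min b c)) by apply: mulr_ge0; lra.
  have : 0 <= u0 * r by apply: mulr_ge0; lra.
  by move=> ? ?; rewrite -(ler_pM2l u01_gt0); lra.
have u02_gt0 : 0 < u0 + u2 by lra.
(* (u0 + u2)(b1 - c1) = (u2 - u1)(b1 - a) + u0 (M - e) + u1 x - u2 y, and (u2 - u1) r = u2 k. *)
have : 0 <= (u2 - u1) * (x + n * r + r - (b1 - a)) by apply: mulr_ge0; lra.
have : 0 <= u0 * (e - M) by apply: mulr_ge0; lra.
have : 0 <= u0 * (x - y + n * k + k) by apply: mulr_ge0; lra.
by move=> ? ? ?; rewrite -(ler_pM2l u02_gt0); lra.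
Qed.

Lemma station1_optimal_second_busy i :
  y <= x -> x <= 2 * y -> mu1 S < mu2 S -> mu2 S <= 2 * mu1 S ->
  v (i, 0, 1, 1)%N <= v (i, 0, 0, 2)%N.
Proof.
move=> le_yx le_x2y lt_mu le_mu.
suff gap : B i - C i <= x - y + i%:R * (h0 S * (m1 S - m2 S) / 2).
  by have [] := station1_second_step i le_yx le_x2y lt_mu le_mu gap.
elim: i => [|i IH].
  by rewrite /B /C value_start1_0 value_start2_0 mul0r addr0.
by have [] := station1_second_step i le_yx le_x2y lt_mu le_mu IH.
Qed.

End Comparisons.

Theorem theorem2p2 (R : realType) (S : clearing_system R) :
  (m1 S * h1 S <= m2 S * h2 S ->
   m1 S <= m2 S ->
   exists p : policy, optimal S p /\
     forall s : state, decision_state_hat s -> p s = Station1)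
  /\
  (m2 S * h2 S <= m1 S * h1 S ->
   m1 S * h1 S <= 2 * (m2 S * h2 S) ->
   m2 S < m1 S -> m1 S <= 2 * m2 S ->
   exists p : policy, optimal S p /\
     forall i : nat, p (i, 1%N, 0%N, 1%N) = Station1).
Proof.
(* Greedy for [value] with ties sent to Station 1, so weak inequalities suffice in both parts. *)
pose p s := if value S (route Station1 s) <= value S (route Station2 s)
            then Station1 else Station2.
have p_opt : optimal S p.
  by move=> s _; rewrite /p; case: leP.
have [u1 u2] := (mu1_gt0 S, mu2_gt0 S); split.
  move=> le_xy; rewrite /m1 /m2 !div1r lef_pV2 ?posrE // => le_mu.
  exists p; split=> // -[[[i j] k] l] hat_s; rewrite /p ifT //.
  have [de ef bc] := station1_optimal R S i le_xy le_mu.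
  by case/or3P: hat_s => /eqP[-> -> ->].
move=> le_yx le_x2y lt_m le_m; exists p; split=> // i; rewrite /p ifT //.
apply: station1_optimal_second_busy => //.
  by move: lt_m; rewrite /m1 /m2 !div1r ltf_pV2 ?posrE.
move: le_m; rewrite /m1 /m2 !div1r -(ler_pM2l (mulr_gt0 u1 u2)) => le_m.
rewrite mulrAC divff ?gt_eqF // mul1r in le_m.
by rewrite mulrCA -mulrA divff ?gt_eqF // mulr1 in le_m.
Qed.
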